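(* Let $n\ge 1$, let $h\in\mathbb{R}$ with $h\neq 0$, let $K$ be a symmetric nonsingular real $n\times n$ matrix, and let $V\colon(\mathbb{R}^n)^4\to\mathbb{R}$ be a symmetric $4$-linear form (so that $W(x)=\frac14V(x,x,x,x)$ is a homogeneous quartic potential). Consider the map $(x_0,x_1)\mapsto(x_1,x_2)$ on $\mathbb{R}^{2n}$ in which $x_2$ is determined by $$\frac{x_2-2x_1+x_0}{h^2}=-K\,V(x_0,x_1,x_2,\cdot).$$ Put $V_{01}:=V(x_0,x_1,\cdot,\cdot)$ and $M_{01}:=I+h^2KV_{01}$. Then the map has the rational first integral $$F(x_0,x_1):=(x_1-x_0)^\top K^{-1}M_{01}^{-1}(x_1-x_0)-\tfrac12\,x_0^\top K^{-1}\left(M_{01}^{-1}-I\right)x_1 .$$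
   Context: $V(x_0,x_1,x_2,\cdot)$ denotes the vector $v\in\mathbb{R}^n$ with $v^\top y=V(x_0,x_1,x_2,y)$ for all $y\in\mathbb{R}^n$. $V(x_0,x_1,\cdot,\cdot)$ denotes the symmetric $n\times n$ matrix $V_{01}$ with $y^\top V_{01}z=V(x_0,x_1,y,z)$ for all $y,z\in\mathbb{R}^n$. The defining equation of the map is equivalent to $M_{01}x_2=2x_1-x_0$, so $x_2$ is uniquely determined wherever $\det M_{01}\ne0$, and the map is a rational map of $\mathbb{R}^{2n}$. A rational function $F$ is a first integral of the map if $F(x_1,x_2)=F(x_0,x_1)$ whenever both sides are defined, i.e. whenever $\det M_{01}\neq0$ and $\det M_{12}\ne 0$, where $M_{12}:=I+h^2KV(x_1,x_2,\cdot,\cdot)$. *)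

(* Defs.v *)
From HB Require Import structures.
From mathcomp Require Import all_boot all_order all_algebra all_fingroup.
From mathcomp Require Import reals.
From mathcomp Require Import mpoly.

Set Implicit Arguments.
Unset Strict Implicit.
Unset Printing Implicit Defensive.

Import Order.TTheory GRing.Theory Num.Theory.
Local Open Scope ring_scope.

Definition form4 (R : realType) (n : nat) : Type :=
  'cV[R]_n -> 'cV[R]_n -> 'cV[R]_n -> 'cV[R]_n -> R.

Definition multilinear4 (R : realType) (n : nat) (V : form4 R n) : Prop :=
  forall a b c : 'cV[R]_n,
    [/\ scalar (fun x => V x a b c), scalar (fun x => V a x b c),
        scalar (fun x => V a b x c) & scalar (fun x => V a b c x)].

Definition symmetric4 (R : realType) (n : nat) (V : form4 R n) : Prop :=
  forall (s : 'S_4) (x : 'I_4 -> 'cV[R]_n),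
    V (x (s 0)) (x (s 1)) (x (s 2)) (x (s 3)) = V (x 0) (x 1) (x 2) (x 3).

(* The vector V(a, b, c, .) and the matrix V(a, b, ., .), given by their entries
   in the standard basis; [form4_vecP] and [form4_mxP] below show that they are
   characterised by v^T y = V(a, b, c, y) and y^T A z = V(a, b, y, z). *)
Definition form4_vec (R : realType) (n : nat) (V : form4 R n)
    (a b c : 'cV[R]_n) : 'cV[R]_n :=
  \col_i V a b c (delta_mx i 0).

Definition form4_mx (R : realType) (n : nat) (V : form4 R n)
    (a b : 'cV[R]_n) : 'M[R]_n :=
  \matrix_(i, j) V a b (delta_mx i 0) (delta_mx j 0).

Definition Mmx (R : realType) (n : nat) (h : R) (K : 'M[R]_n) (V : form4 R n)
    (a b : 'cV[R]_n) : 'M[R]_n :=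
  1%:M + h ^+ 2 *: (K *m form4_mx V a b).

Definition defined_at (R : realType) (n : nat) (h : R) (K : 'M[R]_n)
    (V : form4 R n) (a b : 'cV[R]_n) : Prop :=
  \det (Mmx h K V a b) != 0.

(* The map (x0, x1) |-> (x1, x2) as the relation "x2 solves the defining
   equation"; [map_eq_exists_unique] shows that it is single-valued and total
   on [defined_at]. *)
Definition map_eq (R : realType) (n : nat) (h : R) (K : 'M[R]_n)
    (V : form4 R n) (x0 x1 x2 : 'cV[R]_n) : Prop :=
  (h ^+ 2)^-1 *: (x2 - 2 *: x1 + x0) = - (K *m form4_vec V x0 x1 x2).

(* The partial function with domain D underlying f is a quotient of two
   polynomials in the n + n coordinates of (a, b), the denominator being
   nonzero everywhere on D. *)
Definition rational_on (R : realType) (n : nat)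
    (D : 'cV[R]_n -> 'cV[R]_n -> Prop) (f : 'cV[R]_n -> 'cV[R]_n -> R) : Prop :=
  exists P Q : {mpoly R[n + n]}, Q != 0 /\
    forall a b : 'cV[R]_n, D a b ->
      let x := fun i : 'I_(n + n) => col_mx a b i 0 in
      Q.@[x] != 0 /\ f a b = P.@[x] / Q.@[x].

Definition rational_first_integral (R : realType) (n : nat)
    (D : 'cV[R]_n -> 'cV[R]_n -> Prop)
    (step : 'cV[R]_n -> 'cV[R]_n -> 'cV[R]_n -> Prop)
    (f : 'cV[R]_n -> 'cV[R]_n -> R) : Prop :=
  rational_on D f /\
  forall x0 x1 x2 : 'cV[R]_n,
    D x0 x1 -> D x1 x2 -> step x0 x1 x2 -> f x1 x2 = f x0 x1.

(* [M 0 0] is the entry of a 1 x 1 matrix; off [defined_at] the value is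
   irrelevant. *)
Definition Fint (R : realType) (n : nat) (h : R) (K : 'M[R]_n) (V : form4 R n)
    (x0 x1 : 'cV[R]_n) : R :=
  let M01 := Mmx h K V x0 x1 in
  ((x1 - x0)^T *m invmx K *m invmx M01 *m (x1 - x0)) 0 0
  - 2^-1 * (x0^T *m invmx K *m (invmx M01 - 1%:M) *m x1) 0 0.

Lemma scalar_basis (R : realType) (n : nat) (f : 'cV[R]_n -> R) :
  scalar f -> forall y : 'cV[R]_n, f y = \sum_i f (delta_mx i 0) * y i 0.
Proof.
move=> fl y.
have f0 : f 0 = 0.
  by have := fl (-1) 0 0; rewrite scaler0 addr0 mulN1r addNr.
have fD u v : f (u + v) = f u + f v by rewrite -{1}[u]scale1r fl mul1r.
have fZ c u : f (c *: u) = c * f u by rewrite -[c *: u]addr0 fl f0 addr0.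
rewrite [y in LHS]matrix_sum_delta (big_morph f fD f0).
by apply: eq_bigr => i _; rewrite big_ord1 fZ mulrC.
Qed.

Lemma form4_vecP (R : realType) (n : nat) (V : form4 R n) (a b c v : 'cV[R]_n) :
  multilinear4 V ->
  (forall y, (v^T *m y) 0 0 = V a b c y) <-> v = form4_vec V a b c.
Proof.
move=> Vl; split=> [vP | -> y].
  apply/colP => i; rewrite mxE -vP mxE (bigD1 i) //= big1 ?addr0.
    by rewrite !mxE !eqxx mulr1.
  by move=> j /negPf ji; rewrite !mxE ji mulr0.
have [_ _ _ l4] := Vl a b c.
by rewrite (scalar_basis l4) mxE; apply: eq_bigr => i _; rewrite !mxE.
Qed.

Lemma form4_mxP (R : realType) (n : nat) (V : form4 R n) (a b : 'cV[R]_n)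
    (A : 'M[R]_n) :
  multilinear4 V ->
  (forall y z, (y^T *m A *m z) 0 0 = V a b y z) <-> A = form4_mx V a b.
Proof.
move=> Vl; split=> [AP | -> y z].
  apply/matrixP => i j; rewrite mxE -AP trmx_delta -rowE mxE (bigD1 j) //= big1.
    by rewrite !mxE !eqxx mulr1 addr0.
  by move=> k /negPf kj; rewrite !mxE kj mulr0.
have [_ _ _ l4] := Vl a b y.
rewrite (scalar_basis l4) mxE; apply: eq_bigr => j _; congr (_ * _).
have [_ _ l3 _] := Vl a b (delta_mx j 0).
by rewrite (scalar_basis l3) mxE; apply: eq_bigr => i _; rewrite !mxE mulrC.
Qed.

Lemma form4_vec_mx (R : realType) (n : nat) (V : form4 R n)
    (a b c : 'cV[R]_n) :
  multilinear4 V -> symmetric4 V ->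
  form4_vec V a b c = form4_mx V a b *m c.
Proof.
move=> Vl Vs; apply/colP => i; rewrite !mxE.
have [_ _ l3 _] := Vl a b (delta_mx i 0).
rewrite (scalar_basis l3); apply: eq_bigr => j _; rewrite mxE; congr (_ * _).
have := Vs (tperm 2 3) (fun k : 'I_4 =>
  tnth [tuple a; b; delta_mx i 0; delta_mx j 0] k).
by rewrite tpermL tpermR !tpermD.
Qed.

Lemma map_eqP (R : realType) (n : nat) (h : R) (K : 'M[R]_n) (V : form4 R n)
    (x0 x1 x2 : 'cV[R]_n) :
  h != 0 -> multilinear4 V -> symmetric4 V ->
  map_eq h K V x0 x1 x2 <-> Mmx h K V x0 x1 *m x2 = 2 *: x1 - x0.
Proof.
move=> h0 Vl Vs; have hh : h ^+ 2 != 0 by rewrite expf_neq0.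
rewrite /map_eq /Mmx form4_vec_mx // mulmxDl mul1mx -scalemxAl mulmxA.
set w := _ *m x2; split=> e.
  have := congr1 (fun u => h ^+ 2 *: u) e.
  rewrite scalerA divff // scale1r scalerN => e'.
  by rewrite -[h ^+ 2 *: w]opprK -e' opprD addrA opprB addrCA subrr addr0.
have -> : x2 - 2 *: x1 + x0 = - (h ^+ 2 *: w).
  by rewrite -addrA [- _ + _]addrC -opprB -e opprD addNKr.
by rewrite scalerN scalerA mulVf // scale1r.
Qed.

Lemma map_eq_exists_unique (R : realType) (n : nat) (h : R) (K : 'M[R]_n)
    (V : form4 R n) (x0 x1 : 'cV[R]_n) :
  h != 0 -> multilinear4 V -> symmetric4 V -> defined_at h K V x0 x1 ->
  exists! x2, map_eq h K V x0 x1 x2.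
Proof.
move=> h0 Vl Vs D.
have Mu : Mmx h K V x0 x1 \in unitmx by rewrite unitmxE unitfE.
exists (invmx (Mmx h K V x0 x1) *m (2 *: x1 - x0)); split.
  by apply/map_eqP => //; rewrite mulKVmx.
by move=> y /(map_eqP _ _ _ _ h0 Vl Vs) <-; rewrite mulKmx.
Qed.

(* Main.v *)
Require Import Defs.
From HB Require Import structures.
From mathcomp Require Import all_boot all_order all_algebra all_fingroup.
From mathcomp Require Import reals.
From mathcomp Require Import mpoly.
From mathcomp Require Import ring.

Set Implicit Arguments.
Unset Strict Implicit.
Unset Printing Implicit Defensive.

Import Order.TTheory GRing.Theory Num.Theory.
Local Open Scope ring_scope.

(** Why the function is a first integral.  Write P for the inverse of K, M01 for
    the matrix M(x0, x1), and S01 = P M01^-1.  The last matrix is symmetric,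
    because P M01 = P + h^2 V01 is, and the map says M01 x2 = 2 x1 - x0, that is
                       S01 x0 = 2 S01 x1 - P x2.
    Expanding
      F(x0, x1) = x1.S01 x1 - 5/2 x0.S01 x1 + x0.S01 x0 + 1/2 x0.P x1
    and eliminating S01 x0 twice, the coefficient of x1.S01 x1 becomes
    1 - 5 + 4 = 0, so that S01 disappears altogether:
      F(x0, x1) = 1/2 x0.P x1 + 1/2 x1.P x2 - x0.P x2       ([Fint_step]).
    The right-hand side is invariant under the exchange of x0 and x2.  So is the
    defining equation of the map ([map_eq_rev]), since V is symmetric; and
    F(a, b) = F(b, a) ([FintC]).  Hence
      F(x1, x2) = F(x2, x1) = F(x0, x1).

    Why it is rational.  The entries of M(a, b) are polynomials in the
    coordinates of a and b, so Cramer's rule M^-1 = (det M)^-1 adj M exhibits F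
    as a quotient with denominator det M ([Fint_rational]); this polynomial is
    nonzero because it takes the value 1 at the origin. *)

(** * Bilinear forms given by a matrix *)

Definition bform (R : comNzRingType) (n : nat) (A : 'M[R]_n)
    (u v : 'cV[R]_n) : R := (u^T *m A *m v) 0 0.

Section BilinearForm.
Variables (R : comNzRingType) (n : nat).
Implicit Types (A B : 'M[R]_n) (u v w : 'cV[R]_n).

Lemma bform_mulmx A B u v : (u^T *m A *m B *m v) 0 0 = bform (A *m B) u v.
Proof. by rewrite /bform mulmxA. Qed.

Lemma bformBl A u v w : bform A (u - v) w = bform A u w - bform A v w.
Proof. by rewrite /bform linearB /= !mulmxBl !mxE. Qed.

Lemma bformBr A u v w : bform A w (u - v) = bform A w u - bform A w v.
Proof. by rewrite /bform !mulmxBr !mxE. Qed.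

Lemma bformZr A c u v : bform A u (c *: v) = c * bform A u v.
Proof. by rewrite /bform -scalemxAr !mxE. Qed.

Lemma bformBm A B u v : bform (A - B) u v = bform A u v - bform B u v.
Proof. by rewrite /bform mulmxBr mulmxBl !mxE. Qed.

Lemma bformZm c A u v : bform (c *: A) u v = c * bform A u v.
Proof. by rewrite /bform -scalemxAr -scalemxAl !mxE. Qed.

Lemma bformC A u v : A^T = A -> bform A u v = bform A v u.
Proof.
move=> sA; rewrite /bform -[in LHS]sA -[in LHS](trmxK v) -!trmx_mul mulmxA.
by rewrite mxE.
Qed.

Lemma bform_map (S : comNzRingType) (f : {rmorphism R -> S}) A u v :
  f (bform A u v) = bform (map_mx f A) (map_mx f u) (map_mx f v).
Proof. by rewrite /bform matrix.map_trmx -!map_mxM [RHS]mxE. Qed.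

End BilinearForm.

(** The hypothesis on [S] eliminates [S *m x0] in favour of [S *m x1]; the
    left-hand side expands with weights 1, -5/2, 1 on [bform S x1 x1],
    [bform S x0 x1] and [bform S x0 x0], for which the multiples of
    [bform S x1 x1] left over sum to 1 - 5 + 4 = 0. *)
Lemma bform_elim {F : numFieldType} (m : nat) (S P : 'M[F]_m)
    (x0 x1 x2 : 'cV[F]_m) :
  S^T = S -> S *m (2 *: x1 - x0) = P *m x2 ->
  bform S (x1 - x0) (x1 - x0) - 2^-1 * (bform S x0 x1 - bform P x0 x1) =
  2^-1 * bform P x0 x1 + 2^-1 * bform P x1 x2 - bform P x0 x2.
Proof.
move=> sS e.
have elim v : bform S v x0 = 2 * bform S v x1 - bform P v x2.
  have -> : bform P v x2 = bform S v (2 *: x1 - x0).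
    by rewrite /bform -!mulmxA e.
  by rewrite bformBr bformZr; ring.
rewrite !(bformBl, bformBr) !elim (bformC x0 x1 sS) elim.
by field.
Qed.

(** * Symmetries of the quartic form *)

Section Map.
Variables (R : realType) (n : nat) (h : R) (K : 'M[R]_n) (V : form4 R n).
Hypotheses (K_sym : K^T = K) (K_unit : K \in unitmx).
Hypotheses (V_lin : multilinear4 V) (V_sym : symmetric4 V).
Implicit Types a b c d : 'cV[R]_n.

Lemma form4C12 a b c d : V a b c d = V b a c d.
Proof.
have := V_sym (tperm 0 1) (fun k : 'I_4 => tnth [tuple a; b; c; d] k).
by rewrite tpermL tpermR !tpermD.
Qed.

Lemma form4C13 a b c d : V a b c d = V c b a d.
Proof.
have := V_sym (tperm 0 2) (fun k : 'I_4 => tnth [tuple a; b; c; d] k).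
by rewrite tpermL tpermR !tpermD.
Qed.

Lemma form4C34 a b c d : V a b c d = V a b d c.
Proof.
have := V_sym (tperm 2 3) (fun k : 'I_4 => tnth [tuple a; b; c; d] k).
by rewrite tpermL tpermR !tpermD.
Qed.

Lemma form4_mxC a b : form4_mx V a b = form4_mx V b a.
Proof. by apply/matrixP => i j; rewrite !mxE form4C12. Qed.

Lemma tr_form4_mx a b : (form4_mx V a b)^T = form4_mx V a b.
Proof. by apply/matrixP => i j; rewrite !mxE form4C34. Qed.

Lemma MmxC a b : Mmx h K V a b = Mmx h K V b a.
Proof. by rewrite /Mmx form4_mxC. Qed.

(** Time reversal: since the map is reversible, the value of the integral at
    (x1, x2) can be computed from a step that runs from (x2, x1) to (x1, x0). *)
Lemma map_eq_rev a b c : map_eq h K V a b c -> map_eq h K V c b a.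
Proof.
rewrite /map_eq; have -> : form4_vec V c b a = form4_vec V a b c.
  by apply/colP => i; rewrite !mxE form4C13.
by move<-; congr (_ *: _); rewrite addrAC [RHS]addrAC [c + a]addrC.
Qed.

(** * The first integral along an orbit *)

Lemma tr_invK : (invmx K)^T = invmx K.
Proof. by rewrite trmx_inv K_sym. Qed.

(** [M] need not be symmetric, but it is self-adjoint for the bilinear form of
    [invmx K], and therefore so is its inverse. *)
Lemma tr_invK_invM a b : defined_at h K V a b ->
  (invmx K *m invmx (Mmx h K V a b))^T = invmx K *m invmx (Mmx h K V a b).
Proof.
move=> D; have Mu : Mmx h K V a b \in unitmx by rewrite unitmxE unitfE.
have adj : (Mmx h K V a b)^T *m invmx K = invmx K *m Mmx h K V a b.
  rewrite /Mmx linearD /= trmx1 linearZ /= trmx_mul K_sym tr_form4_mx.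
  rewrite mulmxDl mulmxDr mul1mx mulmx1 -scalemxAl -scalemxAr.
  by rewrite mulmxK // mulKmx.
have MTu : (Mmx h K V a b)^T \in unitmx by rewrite unitmx_tr.
rewrite trmx_mul tr_invK trmx_inv.
by apply: (canLR (mulKmx MTu)); rewrite mulmxA adj mulmxK.
Qed.

Lemma FintE a b :
  Fint h K V a b =
    let S := invmx K *m invmx (Mmx h K V a b) in
    bform S (b - a) (b - a) - 2^-1 * (bform S a b - bform (invmx K) a b).
Proof. by rewrite /Fint /= !bform_mulmx mulmxBr mulmx1 bformBm. Qed.

Lemma FintC a b : defined_at h K V a b -> Fint h K V a b = Fint h K V b a.
Proof.
move=> D; rewrite !FintE /= -(MmxC a b); move: (tr_invK_invM D).
move: (_ *m _) => S sS.
rewrite (bformC b a sS) (bformC b a tr_invK) !(bformBl, bformBr).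
by rewrite (bformC b a sS); ring.
Qed.

Lemma Fint_step a b c : h != 0 -> defined_at h K V a b -> map_eq h K V a b c ->
  Fint h K V a b =
    2^-1 * bform (invmx K) a b + 2^-1 * bform (invmx K) b c
    - bform (invmx K) a c.
Proof.
move=> h0 D /(map_eqP _ _ _ _ h0 V_lin V_sym) e; rewrite FintE.
apply: bform_elim; first exact: tr_invK_invM.
have Mu : Mmx h K V a b \in unitmx by rewrite unitmxE unitfE.
by rewrite -e -mulmxA mulKmx.
Qed.

(** * Rationality *)

Lemma form4_mxE a b i j :
  form4_mx V a b i j =
  \sum_k \sum_l V (delta_mx k 0) (delta_mx l 0) (delta_mx i 0) (delta_mx j 0)
                * a k 0 * b l 0.
Proof.
rewrite mxE; have [l1 _ _ _] := V_lin b (delta_mx i 0) (delta_mx j 0).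
rewrite (scalar_basis l1); apply: eq_bigr => k _.
have [_ l2 _ _] := V_lin (delta_mx k 0) (delta_mx i 0) (delta_mx j 0).
rewrite (scalar_basis l2) mulr_suml; apply: eq_bigr => l _.
by rewrite mulrAC.
Qed.

Local Notation poly := {mpoly R[n + n]}.

(** The generic point: [Xmx] and [Ymx] are the vectors of coordinate functions
    of the first and of the second argument, and [Mpoly] is [Mmx] there. *)
Definition Xmx : 'cV[poly]_n := \col_i 'X_(lshift n i).
Definition Ymx : 'cV[poly]_n := \col_i 'X_(rshift n i).
Definition Cmx (A : 'M[R]_n) : 'M[poly]_n := map_mx (@mpolyC (n + n) R) A.
Definition Mpoly : 'M[poly]_n :=
  1%:M + (h ^+ 2)%:MP *: (Cmx K *m \matrix_(i, j) \sum_k \sum_l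
    (V (delta_mx k 0) (delta_mx l 0) (delta_mx i 0) (delta_mx j 0))%:MP
    * Xmx k 0 * Ymx l 0).

Section Evaluation.
Variables a b : 'cV[R]_n.
Local Notation ev := (meval (fun i : 'I_(n + n) => col_mx a b i 0)).

Lemma map_Xmx : map_mx ev Xmx = a.
Proof. by apply/colP => i; rewrite !mxE mevalXU col_mxEu. Qed.

Lemma map_Ymx : map_mx ev Ymx = b.
Proof. by apply/colP => i; rewrite !mxE mevalXU col_mxEd. Qed.

Lemma map_Cmx A : map_mx ev (Cmx A) = A.
Proof. by apply/matrixP => i j; rewrite !mxE mevalC. Qed.

Lemma map_Mpoly : map_mx ev Mpoly = Mmx h K V a b.
Proof.
rewrite /Mpoly /Mmx map_mxD map_mx1 map_mxZ map_mxM map_Cmx /= mevalC.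
congr (_ + _ *: (_ *m _)); apply/matrixP => i j.
rewrite form4_mxE mxE mxE rmorph_sum; apply: eq_bigr => k _.
rewrite rmorph_sum; apply: eq_bigr => l _ /=.
by rewrite !mxE !mevalM mevalC !mevalXU col_mxEu col_mxEd.
Qed.

Lemma meval_det_Mpoly : ev (\det Mpoly) = \det (Mmx h K V a b).
Proof. by rewrite -map_Mpoly det_map_mx. Qed.

End Evaluation.

Lemma det_Mpoly_neq0 : \det Mpoly != 0.
Proof.
apply/eqP => D0; have := meval_det_Mpoly 0 0.
have -> : Mmx h K V 0 0 = 1%:M.
  rewrite /Mmx; have -> : form4_mx V 0 0 = 0.
    apply/matrixP => i j; rewrite form4_mxE big1 ?mxE // => k _.
    by rewrite big1 // => l _; rewrite !mxE mulr0.
  by rewrite mulmx0 scaler0 addr0.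
by rewrite D0 meval0 det1 => /esym/eqP; rewrite oner_eq0.
Qed.

Lemma Fint_rational : rational_on (defined_at h K V) (Fint h K V).
Proof.
pose Q := \det Mpoly.
(* [S] is the matrix of [FintE] with the denominator cleared. *)
pose S := Cmx (invmx K) *m \adj Mpoly.
pose N := bform S (Ymx - Xmx) (Ymx - Xmx)
          - (2^-1)%:MP * (bform S Xmx Ymx - Q * bform (Cmx (invmx K)) Xmx Ymx).
exists N, Q; split=> [|a b D x]; first exact: det_Mpoly_neq0.
have QE : Q.@[x] = \det (Mmx h K V a b) by exact: meval_det_Mpoly.
have SE : map_mx (meval x) S = invmx K *m \adj (Mmx h K V a b).
  by rewrite map_mxM map_mx_adj map_Cmx map_Mpoly.
have Q0 : \det (Mmx h K V a b) != 0 := D.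
split; first by rewrite QE.
have Mu : Mmx h K V a b \in unitmx by rewrite unitmxE unitfE.
rewrite FintE /= /invmx Mu -scalemxAr !bformZm -/(invmx K) QE.
rewrite /N mevalB !mevalM mevalB mevalM mevalC QE !bform_map SE.
rewrite map_mxB map_Xmx map_Ymx map_Cmx.
by field.
Qed.

End Map.

Theorem theorem1 (R : realType) (n : nat) (n_ge1 : (1 <= n)%N)
    (h : R) (h_neq0 : h != 0)
    (K : 'M[R]_n) (K_sym : K^T = K) (K_unit : K \in unitmx)
    (V : form4 R n) (V_lin : multilinear4 V) (V_sym : symmetric4 V) :
  rational_first_integral (defined_at h K V) (map_eq h K V) (Fint h K V).
Proof.
split=> [|x0 x1 x2 D01 D12 step]; first exact: Fint_rational.
have D21 : defined_at h K V x2 x1 by rewrite /defined_at MmxC.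
have F01 := Fint_step K_sym K_unit V_lin V_sym h_neq0 D01 step.
have F21 := Fint_step K_sym K_unit V_lin V_sym h_neq0 D21
  (map_eq_rev V_sym step).
rewrite FintC // F21 F01.
have PC u v : bform (invmx K) u v = bform (invmx K) v u.
  by apply: bformC; exact: tr_invK.
by rewrite (PC x2 x1) (PC x1 x0) (PC x2 x0); ring.
Qed.
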